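(* Let $1\le k\le n$, let $A\in\mathbb{R}^{n\times n}$ be symmetric positive definite, let $b\in\mathbb{R}^n$, and let $E\in\mathbb{R}^{n\times k}$ be such that $E^T\in\mathbb{R}^{k\times n}$ has Kruskal rank $k$. Put $$\tilde A=\begin{bmatrix} A & AE\\ E^T A & E^T A E\end{bmatrix},\qquad \tilde b=\begin{bmatrix} b\\ E^T b\end{bmatrix}.$$ Let $\mathcal F$ be an arbitrary subset of $[n]=\{1,\dots,n\}$ with $|\mathcal F|\le k$. Then for every $f\in\mathbb{R}^{|\mathcal F|}$ there exists a solution $\tilde x\in\mathbb{R}^{n+k}$ of $\tilde A\tilde x=\tilde b$ with $\tilde x_{\mathcal F}=f$. When $|\mathcal F|=k$, such a solution is unique.
   Context: The Kruskal rank of a matrix is the largest number $k$ such that every subset of $k$ of its columns is linearly independent. For an index set $\mathcal F$, $\tilde x_{\mathcal F}$ denotes the subvector of $\tilde x$ consisting of the components indexed by $\mathcal F$ (in increasing order of index). *)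

(* Defs.v *)
From mathcomp Require Import all_boot all_order all_algebra.
From mathcomp Require Import reals.

Set Implicit Arguments.
Unset Strict Implicit.
Unset Printing Implicit Defensive.

Import Order.TTheory GRing.Theory Num.Theory.
Local Open Scope ring_scope.

(* Subsets of columns are sets of indices: a repeated column makes the family
   dependent.  The range of r is bounded by the number p of columns because the
   condition holds vacuously for r > p. *)
Definition kruskal_rank (K : fieldType) (m p : nat) (M : 'M[K]_(m, p)) : nat :=
  \max_(r < p.+1 | [forall S : {set 'I_p},
                      (#|S| == r) ==> free [seq col j M | j in S]]) r.

Definition sym_posdef (R : realType) (n : nat) (A : 'M[R]_n) : Prop :=
  A \is symmetricmx /\
  forall x : 'cV[R]_n, x != 0 -> 0 < (x^T *m A *m x) 0 0.

(* enum_val lists the elements of a set of ordinals in increasing order. *)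
Definition subvec (R : Type) (n : nat) (F : {set 'I_n}) (x : 'cV[R]_n) :
    'cV[R]_#|F| :=
  rowsub (fun i : 'I_#|F| => enum_val i) x.

Definition ext_mx (R : realType) (n k : nat) (A : 'M[R]_n) (E : 'M[R]_(n, k)) :
    'M[R]_(n + k) :=
  block_mx A (A *m E) (E^T *m A) (E^T *m A *m E).

Definition ext_rhs (R : realType) (n k : nat) (b : 'cV[R]_n)
    (E : 'M[R]_(n, k)) : 'cV[R]_(n + k) :=
  col_mx b (E^T *m b).

(* Main.v *)
Require Import Defs.
From mathcomp Require Import all_boot all_order all_algebra.
From mathcomp Require Import reals.

Import Order.TTheory GRing.Theory Num.Theory.
Local Open Scope ring_scope.

(** Writing [x = col_mx u v], the upper block of the extended system reads
    [A *m (u + E *m v) = b], and the lower block is this equation multiplied by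
    [E^T].  As [A] is invertible ([sym_posdef_unitmx]), the solutions are the
    vectors with [u = invmx A *m b - E *m v], [v] being arbitrary
    ([ext_mx_solutionE]): they form an affine space of dimension [k]
    parametrised by [v].  Prescribing the entries of [u] in [F] therefore
    amounts to the linear system [E_F *m v = (invmx A *m b)_F - f], where [E_F]
    consists of the rows of [E] indexed by [F].  The Kruskal rank hypothesis
    makes these at most [k] rows independent ([kruskal_rank_row_free]), so the
    system is solvable; when [F] has [k] elements, [E_F] is square and
    invertible, and [v], hence [u], is determined. *)

(** The maximum defining the Kruskal rank is attained, because [r = 0] always
    qualifies; a set [F] smaller than the maximiser is enlarged to one of that
    exact size, and independence passes to subfamilies. *)
Lemma kruskal_rank_free (K : fieldType) (m p : nat) (M : 'M[K]_(m, p))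
    (F : {set 'I_p}) :
  (#|F| <= kruskal_rank M)%N -> free [seq col j M | j in F].
Proof.
rewrite /kruskal_rank.
pose P (r : 'I_p.+1) := [forall S : {set 'I_p},
  (#|S| == r) ==> free [seq col j M | j in S]].
have P_gt0 : (0 < #|P|)%N.
  apply/card_gt0P; exists ord0; apply/forallP => S; apply/implyP => /eqP S0.
  by rewrite /image_mem (cards0_eq S0) enum_set0 nil_free.
have [r /forallP Pr ->] := eq_bigmax_cond (fun r : 'I_p.+1 => r : nat) P_gt0.
move=> leFr; set t := take (r - #|F|) (enum (~: F)).
have sz_t : size t = (r - #|F|)%N.
  by rewrite size_takel // -cardE leq_subLR cardsC card_ord -ltnS.
have uniq_Ft : uniq (enum F ++ t).
  rewrite cat_uniq enum_uniq take_uniq ?enum_uniq // andbT /=.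
  by apply/hasPn => j /mem_take; rewrite !mem_enum inE.
have perm_Ft : perm_eq (enum [set:: enum F ++ t]) (enum F ++ t).
  apply: uniq_perm; rewrite ?enum_uniq // => j.
  by rewrite mem_enum inE.
(* The union is enumerated in increasing order, which interleaves [F] and [t];
   freeness is invariant under this permutation. *)
have := Pr [set:: enum F ++ t].
rewrite cardE (perm_size perm_Ft) size_cat sz_t -cardE subnKC // eqxx /=.
by rewrite (perm_free (perm_map _ perm_Ft)) map_cat => /catl_free.
Qed.

(** Turns independence of a family of vectors into a matrix rank condition,
    the form in which one-sided inverses are available. *)
Lemma free_cols_row_free (K : fieldType) (m p : nat) (M : 'M[K]_(m, p))
    (F : {set 'I_p}) :
  free [seq col j M | j in F] ->
  row_free (rowsub (fun i : 'I_#|F| => enum_val i) M^T).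
Proof.
move=> freeF; apply/inj_row_free => v v_ker; apply/rowP => i; rewrite mxE.
have /freeP : free (image_tuple (fun j => col j M) F) by [].
move=> /(_ (fun j => v 0 j)) indep; apply: indep.
apply/colP => j; move/rowP/(_ j): v_ker; rewrite !mxE => <-.
rewrite summxE; apply: eq_bigr => l _.
by rewrite !mxE (nth_image 0) mxE.
Qed.

Lemma kruskal_rank_row_free (K : fieldType) (n k : nat) (E : 'M[K]_(n, k))
    (F : {set 'I_n}) :
  (#|F| <= kruskal_rank E^T)%N ->
  row_free (rowsub (fun i : 'I_#|F| => enum_val i) E).
Proof. by move=> /kruskal_rank_free/free_cols_row_free; rewrite trmxK. Qed.

(** A vector killed by [A] is isotropic for the form [x^T *m A *m x], hence
    zero. *)
Lemma sym_posdef_unitmx (R : realType) (n : nat) (A : 'M[R]_n) :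
  sym_posdef A -> A \in unitmx.
Proof.
move=> [_ posA]; rewrite -row_free_unit; apply/inj_row_free => v vA0.
apply/eqP; apply: contraT => v_neq0; have := posA v^T.
by rewrite trmxK vA0 mul0mx mxE ltxx trmx_eq0 => /(_ v_neq0).
Qed.

(** The extended matrix is [col_mx 1%:M E^T *m A *m row_mx 1%:M E]: its lower
    block row repeats the upper one through [E^T], so only
    [A *m (u + E *m v) = b] remains. *)
Lemma ext_mx_solutionE (R : realType) (n k : nat) (A : 'M[R]_n)
    (b u : 'cV[R]_n) (E : 'M[R]_(n, k)) (v : 'cV[R]_k) :
  A \in unitmx ->
  ext_mx A E *m col_mx u v = ext_rhs b E <-> u = invmx A *m b - E *m v.
Proof.
move=> unitA; rewrite /ext_mx /ext_rhs mul_block_col.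
rewrite -!mulmxA -!mulmxDr; split.
  move=> /eq_col_mx[Auv _].
  by rewrite -Auv mulKmx // addrK.
by move=> ->; rewrite subrK mulKVmx.
Qed.

Arguments ext_mx_solutionE {R n k A b u E v}.

Lemma subvec_solutionE (R : realType) (n k : nat) (s : 'cV[R]_n)
    (E : 'M[R]_(n, k)) (v : 'cV[R]_k) (F : {set 'I_n}) (f : 'cV[R]_#|F|) :
  subvec F (s - E *m v) = f <->
  rowsub (fun i : 'I_#|F| => enum_val i) E *m v = subvec F s - f.
Proof.
rewrite /subvec mul_rowsub_mx linearB /=.
by split=> [<-|->]; rewrite opprB addrC subrK.
Qed.

Theorem proposition4 (R : realType) (n k : nat) (hk : (1 <= k <= n)%N)
    (A : 'M[R]_n) (hA : sym_posdef A) (b : 'cV[R]_n)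
    (E : 'M[R]_(n, k)) (hE : kruskal_rank E^T = k)
    (F : {set 'I_n}) (hF : (#|F| <= k)%N) :
  (forall f : 'cV[R]_#|F|, exists x : 'cV[R]_(n + k),
      ext_mx A E *m x = ext_rhs b E /\ subvec F (usubmx x) = f) /\
  (#|F| = k ->
   forall f : 'cV[R]_#|F|, exists! x : 'cV[R]_(n + k),
      ext_mx A E *m x = ext_rhs b E /\ subvec F (usubmx x) = f).
Proof.
have unitA := sym_posdef_unitmx _ _ _ hA.
pose EF := rowsub (fun i : 'I_#|F| => enum_val i) E.
have freeEF : row_free EF by apply: kruskal_rank_row_free; rewrite hE.
have solvable f : exists x : 'cV[R]_(n + k),
    ext_mx A E *m x = ext_rhs b E /\ subvec F (usubmx x) = f.
  have [B EFB] := row_freeP freeEF.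
  pose v := B *m (subvec F (invmx A *m b) - f).
  exists (col_mx (invmx A *m b - E *m v) v); split.
    exact/ext_mx_solutionE.
  by rewrite col_mxKu; apply/subvec_solutionE; rewrite mulmxA EFB mul1mx.
split=> // cardF f; have [x xP] := solvable f; exists x; split=> // y yP.
(* A row-free square matrix also has full column rank, so [mulmx EF] is
   injective. *)
have fullEF : row_full EF by rewrite /row_full (eqP freeEF) cardF.
move: xP yP; rewrite -[x]vsubmxK -[y]vsubmxK !col_mxKu.
move=> [/(ext_mx_solutionE unitA) xu xf].
move=> [/(ext_mx_solutionE unitA) yu yf].
rewrite xu yu in xf yf *.
suff -> : dsubmx x = dsubmx y by [].
move/subvec_solutionE: xf; move/subvec_solutionE: yf => <-.
exact: row_full_inj.
Qed.
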